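(* Let $T$ be a tree with nullity $1$ that has no eigenvalue in $(0,1)\cup(1,2)$. Then either $T$ is the one-vertex tree or $T=S(p)$ for some integer $p\geqslant 1$.
   Context: Eigenvalues are adjacency eigenvalues; the nullity of a graph is the multiplicity of $0$ as an eigenvalue. For a nonnegative integer $p$, $S(p)$ denotes the tree obtained from the path $v_1v_2v_3$ by attaching $p$ new leaves to $v_2$ and then attaching one new pendant vertex to each vertex of degree $1$ of the resulting tree; equivalently, $S(p)$ is the tree consisting of a center vertex $v_2$ together with $p+2$ pendant paths of length $2$ attached at $v_2$. *)

(* Defs.v *)
From HB Require Import structures.
From mathcomp Require Import all_boot all_order all_algebra.
From mathcomp Require Import reals.

Set Implicit Arguments.
Unset Strict Implicit.
Unset Printing Implicit Defensive.

Import Order.TTheory GRing.Theory Num.Theory.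
Local Open Scope ring_scope.

(* A graph is given by its adjacency relation on a finite vertex type. *)
Definition simple_graph (V : finType) (e : rel V) : Prop :=
  symmetric e /\ irreflexive e.

Definition connected_graph (V : finType) (e : rel V) : Prop :=
  (0 < #|V|)%N /\ forall x y : V, connect e x y.

(* The bound on the length excludes the empty sequence and the closed walks
   x, y, x along a single edge, both of which satisfy [ucycle]. *)
Definition acyclic_graph (V : finType) (e : rel V) : Prop :=
  forall c : seq V, (2 < size c)%N -> ~ ucycle e c.

Definition is_tree (V : finType) (e : rel V) : Prop :=
  [/\ simple_graph e, connected_graph e & acyclic_graph e].

Definition graph_iso (V W : finType) (e : rel V) (e' : rel W) : Prop :=
  exists2 f : V -> W, bijective f & forall x y : V, e' (f x) (f y) = e x y.

Definition adjacency (R : realType) (V : finType) (e : rel V) : 'M[R]_#|V| :=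
  \matrix_(i, j) (e (enum_val i) (enum_val j))%:R.

Definition nullity (R : realType) (V : finType) (e : rel V) : nat :=
  mup 0 (char_poly (adjacency R e)).

(* Vertices of S(p): [None] is the center v_2; for each of the p + 2 indices i,
   the pendant path of length 2 is None -- Some (i, false) -- Some (i, true). *)
Definition S_vertex (p : nat) : finType := option ('I_p.+2 * bool)%type.

Definition S_edge (p : nat) : rel (S_vertex p) := fun x y =>
  match x, y with
  | None, Some (_, b) | Some (_, b), None => ~~ b
  | Some (i, b), Some (j, c) => (i == j) && (b != c)
  | None, None => false
  end.
Arguments S_edge : clear implicits.

(* Main.v *)
Require Import Defs.
From HB Require Import structures.
From mathcomp Require Import all_boot all_order all_algebra.
From mathcomp Require Import reals.
From mathcomp Require Import complex spectral sesquilinear ring lra zify.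

(* Let f span the kernel of the adjacency matrix A, and root the tree at a
   vertex r with f(r) <> 0.  The kernel is supported on the vertices at even
   distance from r, hence a vector w supported on the set Y of vertices at odd
   distance is orthogonal to it.  The spectrum of A is symmetric about 0, so A
   has no eigenvalue in (-1, 0) either, and |w| <= |A w|: with N the Y x V block
   of A, the matrix N N^T - 1 is positive semidefinite.  Its entries are degrees
   minus one and numbers of common neighbours.

   If some y in Y had no child, then f would vanish at its parent x, so x would
   have a parent z in Y; but the diagonal entry at y would be 0 and the entry at
   (y, z) would not.  Since A has rank at most 2|Y|, at most |Y| vertices other
   than r are at even distance, so every y in Y has exactly one child, hence
   degree 2.  Testing N N^T - 1 on the vector (1, -1, 1) then shows that having
   a common neighbour is transitive on Y, and this bounds by 2 the distances
   from a suitable even vertex.  So the tree is a spider with k legs of length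
   2.  It has the eigenvalue sqrt (k + 1), which lies in (1, 2) for k = 1 and
   k = 2. *)

Set Implicit Arguments.
Unset Strict Implicit.
Unset Printing Implicit Defensive.

Import Order.TTheory GRing.Theory Num.Theory.
Local Open Scope ring_scope.

(** * Linear algebra *)

Lemma dvdp_det_rows (F : fieldType) (n : nat) (M : 'M[{poly F}]_n)
    (Q : pred 'I_n) (d : {poly F}) :
  (forall i j, Q i -> d %| M i j) -> d ^+ #|Q| %| \det M.
Proof.
move=> dvdM.
pose D : 'rV[{poly F}]_n := \row_i (if Q i then d else 1).
pose W : 'M[{poly F}]_n := \matrix_(i, j) (if Q i then M i j %/ d else M i j).
have -> : M = diag_mx D *m W.
  apply/matrixP => i j; rewrite mul_diag_mx !mxE; case: ifP => Qi.
    by rewrite mulrC divpK // dvdM.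
  by rewrite mul1r.
rewrite det_mulmx det_diag dvdp_mulr // -prodr_const big_mkcond /=.
by under [X in _ %| X]eq_bigr do rewrite mxE.
Qed.

Lemma row_ebase_sub (F : fieldType) (m n : nat) (A : 'M[F]_(m, n)) (i : 'I_n) :
  (i < \rank A)%N -> (row i (row_ebase A) <= A)%MS.
Proof.
move=> i_lt; rewrite -(eq_row_base A).
suff -> : row i (row_ebase A) = row (Ordinal i_lt) (row_base A).
  exact: row_sub.
apply/rowP => k; rewrite !mxE (bigD1 i) //= big1 => [|l li].
  by rewrite !mxE eqxx i_lt mul1r addr0.
by rewrite !mxE /= eq_sym (inj_eq val_inj) (negPf li) mul0r.
Qed.

(* The characteristic matrix, multiplied by an invertible matrix whose first
   rows are eigenvectors, has these rows divisible by ['X - a%:P]. *)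
Lemma rank_eigenspace_le_mup (F : fieldType) (n : nat) (A : 'M[F]_n) (a : F) :
  (\rank (eigenspace A a) <= mup a (char_poly A))%N.
Proof.
set r := \rank _; pose L := row_ebase (eigenspace A a).
pose M := map_mx polyC L *m char_poly_mx A.
have le_rn : (r <= n)%N by exact: rank_leq_row.
have dvdM (i j : 'I_n) : (i < r)%N -> 'X - a%:P %| M i j.
  move=> ir; have -> : M i j = ('X - a%:P) * (L i j)%:P; last exact: dvdp_mulr.
  have eigL : \sum_k L i k * A k j = a * L i j.
    have /eigenspaceP/rowP/(_ j) := row_ebase_sub ir.
    by rewrite !mxE => <-; apply: eq_bigr => k _; rewrite mxE.
  rewrite /M /char_poly_mx mulmxBr mul_mx_scalar -map_mxM !mxE mulrBl -polyCM.
  by rewrite -eigL.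
have cardr : #|[pred i : 'I_n | (i < r)%N]| = r.
  by rewrite -sum1_card (big_ord_narrow le_rn) sum1_card card_ord.
have := dvdp_det_rows (Q := [pred i : 'I_n | (i < r)%N]) (fun i j => @dvdM i j).
rewrite cardr det_mulmx det_map_mx mul_polyC dvdpZr -/(char_poly A); last first.
  by rewrite -unitfE -unitmxE row_ebase_unit.
by rewrite mup_geq // monic_neq0 // char_poly_monic.
Qed.

Lemma mxrank_row_support (F : fieldType) (m n : nat) (M : 'M[F]_(m, n))
    (Q : pred 'I_m) :
  (forall i j, ~~ Q i -> M i j = 0) -> (\rank M <= #|Q|)%N.
Proof.
move=> M0; pose rowQ (k : 'I_#|Q|) := enum_val k.
apply: leq_trans (rank_leq_row (rowsub rowQ M)).
apply/mxrankS/row_subP => i; case: (boolP (Q i)) => Qi.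
  by rewrite -[i in row i M](enum_rankK_in Qi Qi) -row_rowsub row_sub.
by rewrite (_ : row i M = 0) ?sub0mx //; apply/rowP => j; rewrite !mxE M0.
Qed.

Lemma mxrank_le_cover (F : fieldType) (m n : nat) (M : 'M[F]_(m, n))
    (Q : pred 'I_m) (Q' : pred 'I_n) :
  (forall i j, ~~ Q i -> ~~ Q' j -> M i j = 0) -> (\rank M <= #|Q| + #|Q'|)%N.
Proof.
move=> M0; pose U : 'M_(m, n) := \matrix_(i, j) (if Q i then M i j else 0).
have -> : M = U + (M - U) by rewrite addrC subrK.
apply: leq_trans (mxrank_add _ _) (leq_add _ _).
  by apply: mxrank_row_support => i j /negPf Qi; rewrite mxE Qi.
rewrite -mxrank_tr; apply: mxrank_row_support => j i Qj; rewrite !mxE.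
by case: (boolP (Q i)) => Qi; rewrite ?subrr // subr0 M0.
Qed.

Lemma submx_kernel_orthogonal (F : fieldType) (n : nat) (S : 'M[F]_n) (x : 'rV_n) :
    S^T = S -> (forall y : 'rV_n, y *m S = 0 -> x *m y^T = 0) -> (x <= S)%MS.
Proof.
move=> symS orth_x; rewrite submxE -[cokermx S]trmxK; apply/eqP/trmx_inj.
rewrite trmx_mul trmxK trmx0; apply/row_matrixP => i; rewrite row0 row_mul.
apply: trmx_inj; rewrite trmx_mul trmxK trmx0 orth_x //.
by rewrite -row_mul -{2}symS -trmx_mul mulmx_coker trmx0 row0.
Qed.

Lemma conj_diag_mx_expr (R : comNzRingType) (n : nat) (P P' : 'M[R]_n)
    (D : 'rV_n) (k : nat) :
    P *m P' = 1%:M ->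
  (P' *m diag_mx D *m P) ^+ k = P' *m diag_mx (\row_i D 0 i ^+ k) *m P.
Proof.
move=> PP'; elim: k => [|k IHk].
  rewrite expr0 (_ : diag_mx _ = 1%:M) ?mulmx1 ?(mulmx1C PP') //.
  by apply/matrixP => i j; rewrite !mxE expr0.
transitivity (P' *m diag_mx (\row_i D 0 i ^+ k) *m P *m (P' *m diag_mx D *m P)).
  by rewrite exprSr IHk.
rewrite !mulmxA -[_ *m P *m P']mulmxA PP' mulmx1.
rewrite -[_ *m diag_mx D]mulmxA mulmx_diag.
by congr (_ *m diag_mx _ *m _); apply/rowP => i; rewrite !mxE exprSr.
Qed.

Lemma eigenvalue_conj_diag_mx (F : fieldType) (n : nat) (P P' : 'M[F]_n)
    (D : 'rV_n) (i : 'I_n) :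
  P *m P' = 1%:M -> eigenvalue (P' *m diag_mx D *m P) (D 0 i).
Proof.
move=> PP'; apply/eigenvalueP; exists (row i P).
  by rewrite -row_mul !mulmxA PP' mul1mx row_mul row_diag_mx -scalemxAl -rowE.
apply: contraTneq (oner_neq0 F) => Pi0; rewrite negbK.
have /rowP/(_ i) : row i (P *m P') = 0 by rewrite row_mul Pi0 mul0mx.
by rewrite PP' !mxE eqxx => /eqP.
Qed.

Lemma map_mx_expr (R S : nzRingType) (f : {rmorphism R -> S}) (n : nat)
    (M : 'M[R]_n) (k : nat) :
  map_mx f (M ^+ k) = map_mx f M ^+ k.
Proof.
elim: k => [|k IHk]; first exact: map_mx1.
by rewrite (exprS M) (exprS (map_mx f M)) map_mxM IHk.
Qed.

Section SymmetricSpectrum.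
Local Open Scope complex_scope.
Local Open Scope sesquilinear_scope.

Lemma symmetric_hermsymmx (R : rcfType) (n : nat) (S : 'M[R]_n) :
  S^T = S -> map_mx (real_complex R) S \is hermsymmx.
Proof.
move=> symS; apply: realsym_hermsym.
  by apply/is_hermitianmxP; rewrite expr0 scale1r map_mx_id // map_trmx symS.
by apply/mxOverP => i j; rewrite mxE complex_real.
Qed.

(* The [w i] are the masses of the spectral measure of [S] at [x]. *)
Lemma symmetric_moments (R : rcfType) (n : nat) (S : 'M[R]_n) (x : 'rV_n) :
    S^T = S ->
  exists d w : 'I_n -> R,
    [/\ forall i, eigenvalue S (d i), forall i, 0 <= w i &
        forall k, (x *m S ^+ k *m x^T) 0 0 = \sum_i w i * d i ^+ k].
Proof.
move=> symS; pose f : {rmorphism R -> R[i]} := real_complex R.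
pose SC := map_mx f S; pose P := spectralmx SC; pose D := spectral_diag SC.
have hermS : SC \is hermsymmx by exact: symmetric_hermsymmx.
have SCE : SC = P ^t* *m diag_mx D *m P.
  rewrite -invmx_unitary ?spectral_unitarymx //.
  exact/orthomx_spectralP/hermitian_normalmx.
have PPt : P *m P ^t* = 1%:M by apply/unitarymxP/spectral_unitarymx.
have DE i : D 0 i = f (complex.Re (D 0 i)).
  have /mxOverP/(_ 0 i) := hermitian_spectral_diag_real hermS.
  by rewrite -/D => /RRe_real.
pose y := map_mx f x *m P ^t*.
exists (fun i => complex.Re (D 0 i)), (fun i => complex.Re (`|y 0 i| ^+ 2)).
have wE i : f (complex.Re (`|y 0 i| ^+ 2)) = `|y 0 i| ^+ 2.
  by apply: RRe_real; rewrite realX ?normr_real.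
split=> [i|i|k].
- rewrite eigenvalue_root_char -(fmorph_root f) map_char_poly -/SC -DE.
  by rewrite -eigenvalue_root_char SCE eigenvalue_conj_diag_mx.
- by rewrite -lecR wE exprn_ge0.
have SkE : map_mx f (S ^+ k) = P ^t* *m diag_mx (\row_i D 0 i ^+ k) *m P.
  by rewrite map_mx_expr -(conj_diag_mx_expr _ _ PPt); congr (_ ^+ k).
have yt : P *m map_mx f x^T = y ^t*.
  rewrite trmx_mul map_mxM trmxCK; congr (_ *m _).
  apply/matrixP => i j; rewrite !mxE; apply/esym/CrealP.
  by rewrite complex_real.
apply: (fmorph_inj f).
transitivity ((y *m diag_mx (\row_i D 0 i ^+ k) *m y ^t*) 0 0).
  rewrite -yt /y !mulmxA -2!(mulmxA (map_mx f x)) -SkE -!map_mxM.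
  by rewrite [RHS]mxE.
rewrite mxE rmorph_sum; apply: eq_bigr => i _.
by rewrite mul_mx_diag rmorphM rmorphXn wE -DE normCK !mxE mulrAC.
Qed.

End SymmetricSpectrum.

Lemma symmetric_mul_expands (R : rcfType) (n : nat) (S : 'M[R]_n) (c : R)
    (x : 'rV_n) :
    S^T = S -> (forall a, eigenvalue S a -> a = 0 \/ c <= a ^+ 2) ->
    (x <= S)%MS ->
  c * (x *m x^T) 0 0 <= (x *m S *m (x *m S)^T) 0 0.
Proof.
move=> symS gapS /submxP[z ->].
have [d [w [eig_d w_ge0 zSz]]] := symmetric_moments z symS.
have -> : z *m S *m (z *m S)^T = z *m S ^+ 2 *m z^T.
  by rewrite trmx_mul symS expr2 -[S * S]/(S *m S) !mulmxA.
have -> : z *m S *m S *m (z *m S *m S)^T = z *m S ^+ 4 *m z^T.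
  by rewrite !trmx_mul symS !exprS expr0 mulr1 -![_ * _]/(_ *m _) !mulmxA.
rewrite !zSz mulr_sumr; apply: ler_sum => i _.
rewrite mulrCA ler_wpM2l //; have [->|c_le] := gapS _ (eig_d i).
  by rewrite !expr0n mulr0.
by rewrite [_ ^+ 4](exprD _ 2 2) ler_wpM2r ?sqr_ge0.
Qed.

(** * The adjacency matrix as an operator on functions *)

Definition two_colouring (V : finType) (e : rel V) (Q : pred V) : Prop :=
  forall u v, e u v -> Q v = ~~ Q u.

Definition codegree (V : finType) (e : rel V) (y z : V) : nat :=
  #|[predI e y & e z]|.

Lemma codegreexx (V : finType) (e : rel V) y : codegree e y y = #|e y|.
Proof. by apply: eq_card => v; rewrite !inE andbb. Qed.

Lemma codegreeC (V : finType) (e : rel V) y z : codegree e y z = codegree e z y.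
Proof. by apply: eq_card => v; rewrite !inE andbC. Qed.

Lemma codegree_gt0P (V : finType) (e : rel V) y z :
  reflect (exists2 v, e y v & e z v) (0 < codegree e y z)%N.
Proof.
apply: (iffP card_gt0P) => -[v]; first by case/andP; exists v.
by move=> yv zv; exists v; apply/andP.
Qed.

Section AdjacencyOperator.
Variables (R : realType) (V : finType) (e : rel V).
Implicit Types (f g w : V -> R) (u v : V) (Q : pred V).

Definition nbr_sum f v : R := \sum_(u | e u v) f u.

Definition adjacency_kernel f : Prop := forall v, nbr_sum f v = 0.

Definition fun_row f : 'rV[R]_#|V| := \row_i f (enum_val i).

Definition row_fun (x : 'rV[R]_#|V|) v : R := x 0 (enum_rank v).

Lemma fun_rowK f : row_fun (fun_row f) =1 f.
Proof. by move=> v; rewrite /row_fun mxE enum_rankK. Qed.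

Lemma row_funK : cancel row_fun fun_row.
Proof. by move=> x; apply/rowP => i; rewrite mxE /row_fun enum_valK. Qed.

Lemma eq_fun_row f g : f =1 g <-> fun_row f = fun_row g.
Proof.
split=> [fg | fg v]; first by apply/rowP => i; rewrite !mxE fg.
by rewrite -(fun_rowK f) fg fun_rowK.
Qed.

Lemma fun_row_eq0 f : (fun_row f == 0) = [forall v, f v == 0].
Proof.
apply/eqP/forallP => [f0 v|f0]; first by rewrite -fun_rowK f0 /row_fun mxE.
by apply/rowP => i; rewrite !mxE; apply/eqP.
Qed.

Lemma scale_fun_row a f : a *: fun_row f = fun_row (fun v => a * f v).
Proof. by apply/rowP => i; rewrite !mxE. Qed.

Lemma sum_enum_val f : \sum_(i < #|V|) f (enum_val i) = \sum_v f v.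
Proof. by rewrite -(big_enum_val _ (A := V)); apply: eq_bigl. Qed.

Lemma fun_row_dot f g : (fun_row f *m (fun_row g)^T) 0 0 = \sum_v f v * g v.
Proof. by rewrite mxE -sum_enum_val; apply: eq_bigr => i _; rewrite !mxE. Qed.

Lemma fun_row_adjacency f : fun_row f *m adjacency R e = fun_row (nbr_sum f).
Proof.
apply/rowP => j; rewrite !mxE /nbr_sum [RHS]big_mkcond -sum_enum_val.
by apply: eq_bigr => i _; rewrite !mxE; case: (e _ _); rewrite ?mulr1 ?mulr0.
Qed.

Lemma eigenvalue_adjacencyP a :
  reflect (exists f, (exists v, f v != 0) /\ forall v, nbr_sum f v = a * f v)
    (eigenvalue (adjacency R e) a).
Proof.
apply: (iffP eigenvalueP) => [[x]|[f [[v fv] eig_f]]].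
  rewrite -(row_funK x) fun_row_adjacency scale_fun_row fun_row_eq0.
  by move=> /eq_fun_row eig_x /forallPn; exists (row_fun x).
exists (fun_row f); last by rewrite fun_row_eq0; apply/forallPn; exists v.
by rewrite fun_row_adjacency scale_fun_row; apply/eq_fun_row.
Qed.

Lemma tr_adjacency : symmetric e -> (adjacency R e)^T = adjacency R e.
Proof. by move=> e_sym; apply/matrixP => i j; rewrite !mxE e_sym. Qed.

Lemma eigenspace_fun_rowP a f :
  reflect (forall v, nbr_sum f v = a * f v)
    (fun_row f <= eigenspace (adjacency R e) a)%MS.
Proof.
apply: (iffP eigenspaceP); rewrite fun_row_adjacency scale_fun_row.
  by move=> /eq_fun_row.
by move=> ?; apply/eq_fun_row.
Qed.

Lemma two_colouring_eigenvalueN Q a :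
    two_colouring e Q ->
  eigenvalue (adjacency R e) a -> eigenvalue (adjacency R e) (- a).
Proof.
move=> colQ /eigenvalue_adjacencyP[f [[v fv] eig_f]].
apply/eigenvalue_adjacencyP; exists (fun u => (-1) ^+ Q u * f u); split.
  by exists v; rewrite mulf_neq0 ?signr_eq0.
move=> u; rewrite mulrCA mulNr -eig_f mulrN -mulNr -signrN mulr_sumr.
by apply: eq_bigr => t /colQ ->; rewrite negbK.
Qed.

Lemma two_colouring_kernel Q f :
    two_colouring e Q -> adjacency_kernel f ->
  adjacency_kernel (fun u => if Q u then 0 else f u).
Proof.
move=> colQ kerf v; case: (boolP (Q v)) => Qv.
  rewrite -[RHS](kerf v); apply: eq_bigr => u /colQ.
  by rewrite Qv => /esym/negPf->.
by apply: big1 => u /colQ; rewrite (negPf Qv) => /esym/negbFE->.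
Qed.

Lemma two_colouring_mxrank Q :
  two_colouring e Q -> (\rank (adjacency R e) <= 2 * #|Q|)%N.
Proof.
move=> colQ; pose Qi := [pred i : 'I_#|V| | Q (enum_val i)].
have -> : #|Q| = #|Qi|.
  rewrite -!sum1_card (reindex (@enum_val V V)) //.
  exact/onW_bij/enum_val_bij.
rewrite mul2n -addnn; apply: mxrank_le_cover => i j /= Qi0 Qj0; rewrite mxE.
by case: (boolP (e _ _)) => // /colQ; rewrite (negPf Qi0) (negPf Qj0).
Qed.

Lemma card_le_mxrank_nullity : (#|V| <= \rank (adjacency R e) + nullity R e)%N.
Proof.
have := rank_eigenspace_le_mup (adjacency R e) 0.
by rewrite mxrank_ker raddf0 subr0 leq_subLR.
Qed.

Lemma nullity_gt0_kernel :
  (0 < nullity R e)%N -> exists f r, f r != 0 /\ adjacency_kernel f.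
Proof.
move=> null_gt0; suff /eigenvalue_adjacencyP[f [[r fr] kerf]] :
    eigenvalue (adjacency R e) 0.
  by exists f, r; split=> // v; rewrite kerf mul0r.
rewrite eigenvalue_root_char; apply: contraLR null_gt0 => /mupNroot.
by rewrite /nullity => ->.
Qed.

Lemma nullity1_kernel_line f g r :
    nullity R e = 1%N -> f r != 0 -> adjacency_kernel f -> adjacency_kernel g ->
  exists a, forall v, g v = a * f v.
Proof.
move=> null1 fr kerf kerg; set E := eigenspace (adjacency R e) 0.
have sub_kernel h : adjacency_kernel h -> (fun_row h <= E)%MS.
  by move=> kerh; apply/eigenspace_fun_rowP => v; rewrite kerh mul0r.
have rank_f : \rank (fun_row f) = 1%N.
  by rewrite rank_rV fun_row_eq0 (introT forallPn) //; exists r.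
have /sub_rVP[a] : (fun_row g <= fun_row f)%MS.
  apply: submx_trans (sub_kernel _ kerg) _.
  rewrite -(mxrank_leqif_sup (sub_kernel _ kerf)) eqn_leq.
  by rewrite mxrankS ?sub_kernel //= rank_f -null1 rank_eigenspace_le_mup.
by rewrite scale_fun_row => /eq_fun_row; exists a.
Qed.

Lemma kernel_orthogonal_expands Q w :
    symmetric e -> two_colouring e Q ->
    (forall a : R, eigenvalue (adjacency R e) a -> ~ (0 < a < 1)) ->
    (forall g, adjacency_kernel g -> \sum_v w v * g v = 0) ->
  \sum_v w v ^+ 2 <= \sum_v nbr_sum w v ^+ 2.
Proof.
move=> e_sym colQ no_eig orth_w.
have sum_sqr h : \sum_v h v ^+ 2 = (fun_row h *m (fun_row h)^T) 0 0.
  by rewrite fun_row_dot; apply: eq_bigr.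
rewrite !sum_sqr -fun_row_adjacency -[X in X <= _]mul1r.
apply: symmetric_mul_expands; first exact: tr_adjacency.
  move=> a eig_a; have [->|a_neq0] := eqVneq a 0; [by left | right].
  have [a_gt0|a_le0] := ltP 0 a.
    rewrite exprn_ege1 // leNgt; apply/negP => a_lt1.
    by apply: (no_eig a); rewrite ?a_gt0.
  rewrite -sqrrN exprn_ege1 // leNgt; apply/negP => a_lt1.
  apply: (no_eig (- a)); first exact: two_colouring_eigenvalueN colQ eig_a.
  by rewrite oppr_gt0 lt_neqAle a_neq0 a_le0 a_lt1.
apply: submx_kernel_orthogonal (tr_adjacency e_sym) _ => y.
rewrite -(row_funK y) fun_row_adjacency => kery; apply/matrixP => i j.
rewrite !ord1 fun_row_dot mxE orth_w // => v.
by rewrite -(fun_rowK (nbr_sum _)) kery /row_fun mxE.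
Qed.

Lemma sum_nbr_sum_sqr w :
  \sum_v nbr_sum w v ^+ 2 = \sum_y \sum_z w y * w z * (codegree e y z)%:R.
Proof.
transitivity (\sum_v \sum_y \sum_z w y * w z * (e y v && e z v)%:R).
  apply: eq_bigr => v _; rewrite expr2 /nbr_sum mulr_suml big_mkcond.
  apply: eq_bigr => y _; case: (e y v) => /=; last first.
    by rewrite big1 // => z _; rewrite mulr0.
  rewrite mulr_sumr big_mkcond; apply: eq_bigr => z _.
  by case: (e z v); rewrite ?mulr1 ?mulr0.
rewrite exchange_big; apply: eq_bigr => y _; rewrite exchange_big.
apply: eq_bigr => z _; rewrite -mulr_sumr -natr_sum; congr (_ * _%:R).
rewrite /codegree -sum1_card [RHS]big_mkcond; apply: eq_bigr => v _.
by rewrite !unfold_in; case: (_ && _).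
Qed.

End AdjacencyOperator.

Lemma graph_iso_eigenvalue (R : realType) (V W : finType) (e : rel V)
    (e' : rel W) (a : R) :
    graph_iso e e' ->
  eigenvalue (adjacency R e') a -> eigenvalue (adjacency R e) a.
Proof.
move=> [h [h' hK h'K] h_edge] /eigenvalue_adjacencyP[f [[v fv] eig_f]].
apply/eigenvalue_adjacencyP; exists (f \o h); split.
  by exists (h' v); rewrite /= h'K.
move=> u; rewrite /= -eig_f /nbr_sum (reindex h) /=; last by exists h' => ? _.
by apply: eq_bigl => w; rewrite h_edge.
Qed.

(** * Rooted trees *)

Section Distance.
Local Open Scope nat_scope.
Variables (V : finType) (e : rel V).
Implicit Types (r u v : V).

Definition has_walk r v (n : nat) : bool :=
  [exists p : n.-tuple V, path e r p && (last r p == v)].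

(* Unreachable vertices are given the impossible distance [#|V|]. *)
Definition dist r v : nat := find (has_walk r v) (iota 0 #|V|).

Lemma dist_last r p : path e r p -> dist r (last r p) <= size p.
Proof.
move=> walk_p; rewrite leqNgt; apply/negP => lt_p.
have lt_pV : size p < #|V|.
  by apply: leq_trans lt_p _; rewrite -[leqRHS](size_iota 0) find_size.
have := before_find 0 lt_p; rewrite nth_iota // => /existsP[].
by exists (in_tuple p); rewrite walk_p eqxx.
Qed.

Lemma exists_shortest_walk r v :
  connect e r v -> exists p, [/\ path e r p, last r p = v & size p = dist r v].
Proof.
case/connectP=> _ /shortenP[p walk_p uniq_p _] ->.
have lt_pV : size p < #|V| by rewrite -[_.+1](card_uniqP uniq_p) max_card.
have : has (has_walk r (last r p)) (iota 0 #|V|).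
  apply/hasP; exists (size p); first by rewrite mem_iota.
  by apply/existsP; exists (in_tuple p); rewrite walk_p eqxx.
move=> walkable; have := nth_find 0 walkable.
rewrite nth_iota; last by rewrite -[ltnRHS](size_iota 0) -has_find.
by case/existsP=> q /andP[walk_q /eqP q_v]; exists q; rewrite size_tuple.
Qed.

Lemma distxx r : dist r r = 0.
Proof. by apply/eqP; rewrite -leqn0 (@dist_last r [::]). Qed.

Lemma dist_eq0 r v : connect e r v -> (dist r v == 0) = (v == r).
Proof.
move=> rv; apply/eqP/eqP => [|->]; last exact: distxx.
by have [[|x p] [_ <- <-]] := exists_shortest_walk rv.
Qed.

Lemma dist_edge_le r u v : connect e r u -> e u v -> dist r v <= (dist r u).+1.
Proof.
move=> ru uv; have [p [walk_p p_u <-]] := exists_shortest_walk ru.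
rewrite -(size_rcons p v) -[in dist r v](last_rcons r p v) dist_last //.
by rewrite rcons_path walk_p p_u.
Qed.

Definition odd_level r : pred V := fun v => odd (dist r v).

Definition parent r v : V :=
  odflt r [pick u | e u v && (dist r v == (dist r u).+1)].

Lemma parentP r v :
    connect e r v -> v != r ->
  e (parent r v) v /\ dist r v = (dist r (parent r v)).+1.
Proof.
move=> rv vr; rewrite /parent.
case: pickP => [u /andP[uv /eqP] //|no_parent].
have [p [+ + +]] := exists_shortest_walk rv.
case/lastP: p => [_ /= r_v|p x]; first by rewrite r_v eqxx in vr.
rewrite rcons_path last_rcons size_rcons => /andP[walk_p pv] xv dist_v; subst x.
have /negP[] := negbT (no_parent (last r p)); rewrite pv -dist_v eqSS eqn_leq.
rewrite dist_last // andbT -ltnS dist_v dist_edge_le //.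
by apply/connectP; exists p.
Qed.

Hypothesis e_conn : forall u v, connect e u v.

Lemma exists_nbr_closer r v n :
  dist r v = n.+1 -> exists2 u, e u v & dist r u = n.
Proof.
move=> dist_v; have [|uv] := parentP (e_conn r v).
  by rewrite -(dist_eq0 (e_conn r v)) dist_v.
by rewrite dist_v => -[->]; exists (parent r v).
Qed.

Lemma exists_dist_eq r v n : n <= dist r v -> exists u, dist r u = n.
Proof.
have [m] := ubnP (dist r v); elim: m v => // m IHm v le_vm le_nv.
have [v_r|/(parentP (e_conn r v))[_ dist_v]] := eqVneq v r.
  by exists r; move: le_nv; rewrite v_r distxx; lia.
have [->|n_neq] := eqVneq n (dist r v); first by exists v.
by apply: (IHm (parent r v)); lia.
Qed.

Lemma two_colouring_odd_level (Q : pred V) r v :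
  two_colouring e Q -> Q v = odd_level r v (+) Q r.
Proof.
move=> colQ; rewrite /odd_level; have [n] := ubnP (dist r v).
elim: n v => // n IHn v le_vn.
have [->|/(parentP (e_conn r v))[pv dist_v]] := eqVneq v r.
  by rewrite distxx.
by rewrite (colQ _ _ pv) IHn ?dist_v /= ?addNb //; lia.
Qed.

End Distance.

Lemma tree_sym (V : finType) (e : rel V) : is_tree e -> symmetric e.
Proof. by case=> -[]. Qed.

Lemma tree_irr (V : finType) (e : rel V) : is_tree e -> irreflexive e.
Proof. by case=> -[]. Qed.

Lemma tree_connect (V : finType) (e : rel V) :
  is_tree e -> forall u v, connect e u v.
Proof. by case=> _ []. Qed.

Section RootedTrees.
Local Open Scope nat_scope.
Variables (V : finType) (e : rel V).
Hypothesis tree_e : is_tree e.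
Implicit Types (r u v w : V).

Local Notation dist := (dist e).
Local Notation parent := (parent e).

Let e_sym := tree_sym tree_e.
Let e_irr := tree_irr tree_e.
Let e_conn := tree_connect tree_e.

Definition edge_avoiding v : rel V := [rel x y | [&& e x y, x != v & y != v]].

Lemma edge_avoiding_connect_sym v : connect_sym (edge_avoiding v).
Proof.
apply: sym_connect_sym => x y.
by rewrite /edge_avoiding /= e_sym [(x != v) && _]andbC.
Qed.

Lemma edge_neq u v : e u v -> u != v.
Proof. by apply: contraTneq => ->; rewrite e_irr. Qed.

Lemma acyclic_no_bypass u v w :
  e u v -> e w v -> connect (edge_avoiding v) u w -> u = w.
Proof.
move=> uv wv /connectP[_ /shortenP[p avoid_p uniq_p _] w_last].
apply/eqP; apply: contraT => uw; exfalso.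
have p_neq_v : all (predC1 v) p.
  by elim: (p) (u) avoid_p => //= x q IHq y /andP[/and3P[_ _ ->]] /IHq //.
have walk_p : path e u p by apply: sub_path avoid_p => x y /and3P[].
have [_ _ e_acyclic] := tree_e; apply: (e_acyclic (v :: u :: p)).
  by case: (p) w_last uw => //= w_last; rewrite w_last eqxx.
rewrite /ucycle /= rcons_path -w_last e_sym uv walk_p wv /=.
move: uniq_p; rewrite inE negb_or eq_sym (edge_neq uv) /= => ->; rewrite andbT.
by apply/negP => /(allP p_neq_v); rewrite /= eqxx.
Qed.

Lemma connect_avoid_root r u v :
  u != v -> dist r u <= dist r v -> connect (edge_avoiding v) u r.
Proof.
have [n] := ubnP (dist r u); elim: n u => // n IHn u le_un uv le_uv.
have [->|/(parentP (e_conn r u))[pu dist_u]] := eqVneq u r.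
  exact: connect0.
have pv : parent r u != v by apply: contraTneq le_uv => <-; lia.
apply: (@connect_trans _ _ (parent r u)); last by apply: IHn; lia.
by apply: connect1; rewrite /edge_avoiding /= e_sym pu uv.
Qed.

Lemma nbr_below_unique r u v w :
  e u v -> e w v -> dist r u <= dist r v -> dist r w <= dist r v -> u = w.
Proof.
move=> uv wv le_uv le_wv; apply: (@acyclic_no_bypass u v w) => //.
apply: (@connect_trans _ _ r); first exact: connect_avoid_root (edge_neq uv) _.
by rewrite edge_avoiding_connect_sym connect_avoid_root ?edge_neq.
Qed.

Lemma nbr_below_parent r u v :
    e u v -> dist r u <= dist r v ->
  dist r v = (dist r u).+1 /\ u = parent r v.
Proof.
move=> uv le_uv; have vr : v != r.
  apply: contraNneq (edge_neq uv) => v_r.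
  by move: le_uv; rewrite v_r distxx leqn0 dist_eq0.
have [pv dist_v] := parentP (e_conn r v) vr.
suff u_p : u = parent r v by rewrite [in dist r u]u_p.
by apply: nbr_below_unique uv pv le_uv _; rewrite dist_v.
Qed.

Lemma eq_parent r u v : e u v -> dist r v = (dist r u).+1 -> parent r v = u.
Proof.
by move=> uv dist_v; have [] := @nbr_below_parent r u v uv; rewrite ?dist_v.
Qed.

Lemma tree_edge r u v :
    e u v ->
  dist r v = (dist r u).+1 /\ u = parent r v \/
  dist r u = (dist r v).+1 /\ v = parent r u.
Proof.
move=> uv; have [le_uv|lt_vu] := leqP (dist r u) (dist r v).
  by left; exact: nbr_below_parent.
by right; apply: nbr_below_parent; [rewrite e_sym | exact: ltnW].
Qed.

Lemma dist_nbr r v : e r v -> dist r v = 1.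
Proof. by case/(tree_edge r)=> -[+ _]; have := distxx e r; lia. Qed.

Lemma dist_eq1 r v : (dist r v == 1) = e r v.
Proof.
apply/eqP/idP => [/(exists_nbr_closer e_conn)[u uv]|]; last exact: dist_nbr.
by move/eqP; rewrite dist_eq0 // => /eqP <-.
Qed.

Lemma odd_level_two_colouring r : two_colouring e (odd_level e r).
Proof.
move=> u v /(tree_edge r)[] [dist_uv _].
  by rewrite /odd_level dist_uv.
by rewrite /odd_level dist_uv negbK.
Qed.

Lemma card_nbrs_one_child r y x :
    y != r -> e y x -> dist r x = (dist r y).+1 ->
    (forall x', e y x' -> dist r x' = (dist r y).+1 -> x' = x) ->
  #|e y| = 2.
Proof.
move=> yr yx dist_x x_unique; have [py dist_y] := parentP (e_conn r y) yr.
have px : parent r y != x by apply: contra_eqN dist_x => /eqP <-; lia.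
rewrite (eq_card (B := pred2 (parent r y) x)) ?card2 ?px // => u.
rewrite !inE; apply/idP/orP => [yu|[] /eqP ->]; last exact: yx.
  have [[dist_u _]|[_ ->]] := tree_edge r yu; [right | by left].
  by rewrite (x_unique u).
by rewrite -topredE /= e_sym.
Qed.

End RootedTrees.

(** * Spiders *)

(* Same encoding as [S_vertex] and [S_edge]: [S_edge p] is convertible to
   [spider_edge p.+2]. *)
Definition spider (k : nat) : finType := option ('I_k * bool)%type.

Definition spider_edge (k : nat) : rel (spider k) := fun x y =>
  match x, y with
  | None, Some (_, b) | Some (_, b), None => ~~ b
  | Some (i, b), Some (j, c) => (i == j) && (b != c)
  | None, None => false
  end.
Arguments spider_edge : clear implicits.

Lemma spider_edge_sym k : symmetric (spider_edge k).
Proof. by move=> [[i b]|] [[j c]|] //=; rewrite eq_sym [b == c]eq_sym. Qed.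

Lemma spider_eigenvalue (R : realType) (k : nat) : (0 < k)%N ->
  eigenvalue (adjacency R (spider_edge k)) (Num.sqrt k.+1%:R).
Proof.
move=> k_gt0; set l : R := Num.sqrt _.
have l2 : l * l = k.+1%:R by rewrite -expr2 sqr_sqrtr.
pose f (x : spider k) : R :=
  match x with None => k%:R | Some (_, b) => if b then 1 else l end.
apply/eigenvalue_adjacencyP; exists f; split.
  by exists None; rewrite pnatr_eq0 -lt0n.
case=> [[i []]|]; rewrite /nbr_sum.
- rewrite (big_pred1 (Some (i, false))) ?mulr1 // => -[[j b]|] //=.
  by rewrite -[RHS]/((j == i) && (b == false)) eqbF_neg; case: b.
- rewrite (bigD1 None) //= (big_pred1 (Some (i, true))) ?l2 ?natr1 //.
  case=> [[j b]|] //=.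
  by rewrite -[RHS]/((j == i) && (b == true)) eqb_id andbT; case: b.
rewrite (reindex_omap (fun i => Some (i, false)) (omap fst)) => [|[[j []]|] //].
rewrite (eq_bigl xpredT) => [|i /=]; last by rewrite eqxx.
by rewrite sumr_const card_ord mulr_natr.
Qed.

Section RadiusTwo.
Local Open Scope nat_scope.
Variables (V : finType) (e : rel V) (c : V).
Hypothesis tree_e : is_tree e.
Hypothesis radius_le2 : forall v, dist e c v <= 2.
Hypothesis deg2 : forall y, e c y -> #|e y| = 2.

Let e_sym := tree_sym tree_e.
Let e_conn := tree_connect tree_e.

Definition leg y : V := odflt c [pick x | e y x && (x != c)].

Lemma legP y : e c y -> dist e c (leg y) = 2 /\ e y =i pred2 c (leg y).
Proof.
move=> cy; have yc : e y c by rewrite e_sym.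
have [yl lc] : e y (leg y) /\ leg y != c.
  rewrite /leg; case: pickP => [x /andP[] //|no_leg].
  suff : 1 < #|pred1 c| by rewrite card1.
  rewrite -(deg2 cy) subset_leq_card //; apply/subsetP => x yx; rewrite inE.
  by have := no_leg x; rewrite [e y x]yx => /negbFE.
split.
  have [[-> _]|[]] := tree_edge tree_e c yl.
    by rewrite (dist_nbr tree_e cy).
  rewrite (dist_nbr tree_e cy) => -[/esym/eqP].
  by rewrite dist_eq0 // (negPf lc).
apply/fsym/subset_cardP; first by rewrite card2 deg2 // eq_sym lc.
by apply/subsetP => x /pred2P[] ->.
Qed.

Lemma parent_leg y : e c y -> parent e c (leg y) = y.
Proof.
move=> cy; have [dist_l y_nbrs] := legP cy.
apply: eq_parent; rewrite ?dist_l ?(dist_nbr tree_e cy) //.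
by have := y_nbrs (leg y); rewrite !inE eqxx orbT.
Qed.

Definition spider_map (x : spider #|e c|) : V :=
  match x with
  | None => c
  | Some (i, b) => if b then leg (enum_val i) else enum_val i
  end.

Lemma arm_edge (i : 'I_#|e c|) : e c (enum_val i).
Proof. exact: enum_valP. Qed.

Lemma dist_spider_map x :
  dist e c (spider_map x) = if x is Some (_, b) then b.+1 else 0.
Proof.
case: x => [[i []]|] /=; last exact: distxx.
  by have [] := legP (arm_edge i).
exact/(dist_nbr tree_e)/arm_edge.
Qed.

Lemma spider_map_inj : injective spider_map.
Proof.
move=> x y eq_xy; have := dist_spider_map x.
rewrite eq_xy dist_spider_map.
case: x y eq_xy => [[i []]|] [[j []]|] //= eq_ij _.
  have := congr1 (parent e c) eq_ij; rewrite !parent_leg ?arm_edge //.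
  by move/enum_val_inj->.
by rewrite (enum_val_inj eq_ij).
Qed.

Lemma spider_map_surj v : exists x, spider_map x = v.
Proof.
have arm y : e c y -> exists i : 'I_#|e c|, enum_val i = y.
  by move=> cy; exists (enum_rank_in cy y); rewrite enum_rankK_in.
have [->|/(parentP (e_conn c v))[pv dist_v]] := eqVneq v c.
  by exists None.
have [pc|/(parentP (e_conn c _))[ppv dist_p]] := eqVneq (parent e c v) c.
  by rewrite pc in pv; have [i <-] := arm v pv; exists (Some (i, false)).
have pp_c : parent e c (parent e c v) = c.
  by apply/eqP; rewrite -(dist_eq0 (e_conn _ _)); have := radius_le2 v; lia.
rewrite pp_c in ppv; have [_ /(_ v)] := legP ppv.
rewrite [v \in _]pv => /esym/pred2P[v_c|v_l].
  by move: dist_v; rewrite v_c distxx.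
by have [i iP] := arm _ ppv; exists (Some (i, true)); rewrite /= iP.
Qed.

Lemma spider_map_edge x y :
  e (spider_map x) (spider_map y) = spider_edge #|e c| x y.
Proof.
have arm_nbrs i z :
    e (enum_val i) (spider_map z) = spider_edge _ (Some (i, false)) z.
  have -> : e (enum_val i) (spider_map z) =
      (z == None) || (z == Some (i, true)).
    rewrite -2!(inj_eq spider_map_inj).
    by have [_ /(_ (spider_map z))] := legP (arm_edge i).
  case: z => [[j b]|] //=.
  by rewrite -[LHS]/((j == i) && (b == true)) eq_sym; case: b.
have same_level u v : odd_level e c u = odd_level e c v -> e u v = false.
  move=> uv; apply/negP => /(odd_level_two_colouring tree_e c).
  by rewrite uv; case: (odd_level _ _ _).
case: x y => [[i []]|] [[j []]|].
- by rewrite same_level /odd_level ?dist_spider_map //= andbF.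
- by rewrite e_sym arm_nbrs spider_edge_sym.
- by rewrite same_level /odd_level ?dist_spider_map.
- exact: arm_nbrs.
- exact: arm_nbrs.
- exact: arm_nbrs.
- by rewrite same_level /odd_level ?dist_spider_map.
- by rewrite e_sym arm_nbrs spider_edge_sym.
- exact: tree_irr tree_e _.
Qed.

Lemma radius2_graph_iso_spider : graph_iso e (spider_edge #|e c|).
Proof.
have /fin_all_exists[g gK] := spider_map_surj.
have hK := inj_can_sym gK spider_map_inj.
by exists g => [|x y]; [exists spider_map | rewrite -spider_map_edge !gK].
Qed.

End RadiusTwo.

(** * Spectral gap and the shape of the tree *)

(* For a colour class [Q] this says that [N N^T >= 1], where [N] is the block of
   the adjacency matrix with rows in [Q]. *)
Definition expanding (R : realType) (V : finType) (e : rel V) (Q : pred V) :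
    Prop :=
  forall w : V -> R, (forall v, ~~ Q v -> w v = 0) ->
    \sum_v w v ^+ 2 <= \sum_v nbr_sum e w v ^+ 2.

Section Expanding.
Variables (R : realType) (V : finType) (e : rel V) (Q : pred V).
Hypothesis expands : expanding R e Q.

Lemma codegree_form_ge (s : seq V) (w : V -> R) : uniq s -> all Q s ->
  \sum_(y <- s) w y ^+ 2 <=
    \sum_(y <- s) \sum_(z <- s) w y * w z * (codegree e y z)%:R.
Proof.
move=> uniq_s /allP Qs; pose w_s v := if v \in s then w v else 0.
have sum_s (F G : V -> R) : (forall v, F v = if v \in s then G v else 0) ->
    \sum_v F v = \sum_(v <- s) G v.
  by move=> FE; rewrite [RHS]big_uniq // [RHS]big_mkcond; apply: eq_bigr => v _.
have := @expands w_s; rewrite sum_nbr_sum_sqr.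
rewrite (sum_s _ (fun y => w y ^+ 2)) => [|v]; last first.
  by rewrite /w_s; case: ifP; rewrite ?expr0n.
rewrite (sum_s _ (fun y => \sum_(z <- s) w y * w z * (codegree e y z)%:R)).
  by apply=> v; rewrite /w_s; case: ifP => // /Qs ->.
move=> y; rewrite {1}/w_s; case: ifP => _; last first.
  by rewrite big1 // => z _; rewrite !mul0r.
by apply: sum_s => z; rewrite /w_s; case: ifP; rewrite ?mulr0 ?mul0r.
Qed.

(* For a pendant vertex [y] the form vanishes at [y], so its whole row does. *)
Lemma pendant_codegree0 y z :
  Q y -> Q z -> y != z -> #|e y| = 1%N -> codegree e y z = 0%N.
Proof.
move=> Qy Qz yz deg_y; apply/eqP; rewrite -leqn0 leqNgt; apply/negP => yz_gt0.
pose w := [eta (fun=> 0) with y |-> - (#|e z|%:R : R), z |-> 1].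
have := @codegree_form_ge [:: y; z] w.
rewrite /= !inE yz Qy Qz !big_cons !big_nil.
rewrite !codegreexx deg_y [codegree e z y]codegreeC.
rewrite eqxx [z == y]eq_sym (negPf yz) eqxx => /(_ isT isT).
have : 1 <= (codegree e y z)%:R :> R by rewrite ler1n.
have : 0 <= #|e z|%:R :> R by exact: ler0n.
nra.
Qed.

(* Otherwise the form is negative at the vector with entries 1, -1, 1 at
   [y], [z], [t]. *)
Lemma codegree_gt0_trans y z t :
    all Q [:: y; z; t] -> uniq [:: y; z; t] ->
    #|e y| = 2%N -> #|e z| = 2%N -> #|e t| = 2%N ->
    (0 < codegree e y z)%N -> (0 < codegree e z t)%N ->
  (0 < codegree e y t)%N.
Proof.
move=> Qs uniq_s deg_y deg_z deg_t yz zt; rewrite lt0n; apply/negP => /eqP yt0.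
pose w : V -> R := [eta (fun=> 0) with y |-> 1, z |-> -1, t |-> 1].
have := codegree_form_ge w uniq_s Qs.
move: uniq_s; rewrite /= !inE negb_or andbT.
case/andP=> /andP[neq_yz neq_yt] neq_zt.
rewrite !big_cons !big_nil !codegreexx deg_y deg_z deg_t.
rewrite [codegree e z y]codegreeC [codegree e t y]codegreeC yt0.
rewrite [codegree e t z]codegreeC.
rewrite /w /= !eqxx [z == y]eq_sym [t == y]eq_sym [t == z]eq_sym.
rewrite (negPf neq_yz) (negPf neq_yt) (negPf neq_zt).
have : 1 <= (codegree e y z)%:R :> R by rewrite ler1n.
have : 1 <= (codegree e z t)%:R :> R by rewrite ler1n.
lra.
Qed.

End Expanding.

Section TreeKernel.
Local Open Scope nat_scope.
Variables (R : realType) (V : finType) (e : rel V) (r : V) (f : V -> R).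
Hypothesis tree_e : is_tree e.
Hypothesis kerf : adjacency_kernel e f.
Hypothesis fr : f r != 0%R.
Local Notation Y := (odd_level e r).
Hypothesis expands : expanding R e Y.
Hypothesis cardV : #|V| <= (2 * #|Y|).+1.

Let e_sym := tree_sym tree_e.
Let e_conn := tree_connect tree_e.

Lemma root_even : ~~ Y r.
Proof. by rewrite /odd_level distxx. Qed.

Lemma odd_vertex_neq_root y : Y y -> y != r.
Proof. by apply: contraTneq => ->; exact: root_even. Qed.

Lemma odd_vertex_has_child y :
  Y y -> exists2 x, e y x & dist e r x = (dist e r y).+1.
Proof.
move=> Yy; have yr := odd_vertex_neq_root Yy.
pose is_child := [pred x | e y x && (dist e r x == (dist e r y).+1)].
case: (pickP is_child) => [x|no_child].
  by case/andP=> yx /eqP; exists x.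
exfalso; set x := parent e r y.
have [xy dist_y] : e x y /\ dist e r y = (dist e r x).+1 by exact: parentP.
have y_nbrs : e y =i pred1 x.
  move=> u; rewrite inE; apply/idP/eqP => [yu|->]; last first.
    by rewrite -topredE /= e_sym.
  have [[/eqP dist_u _]|[] //] := tree_edge tree_e r yu.
  by have := no_child u; rewrite /= [e y u]yu dist_u.
have fx0 : f x = 0%R.
  rewrite -(kerf y) /nbr_sum (big_pred1 x) // => u.
  by rewrite e_sym; exact: y_nbrs.
have [zx dist_x] :
    e (parent e r x) x /\ dist e r x = (dist e r (parent e r x)).+1.
  by apply: parentP => //; apply: contraNneq fr => <-; rewrite fx0.
have Yz : Y (parent e r x).
  by move: Yy; rewrite /odd_level dist_y dist_x /= negbK.
have yz : y != parent e r x.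
  by apply/eqP => yz; move: dist_y; rewrite [in LHS]yz; lia.
have deg_y : #|e y| = 1 by rewrite (eq_card y_nbrs) card1.
have := pendant_codegree0 expands Yy Yz yz deg_y; apply/eqP; rewrite -lt0n.
by apply/codegree_gt0P; exists x => //; rewrite e_sym.
Qed.

Let even_nonroot : pred V := [pred x | ~~ Y x & x != r].

Lemma child_even y x :
  Y y -> dist e r x = (dist e r y).+1 -> x \in even_nonroot.
Proof.
move=> Yy dist_x; rewrite inE /odd_level dist_x /= negbK [odd _]Yy.
by rewrite -(dist_eq0 (e_conn r x)) dist_x.
Qed.

(* Every odd vertex is a parent and there are at least as many odd vertices as
   even non-root ones. *)
Lemma parent_inj_even : {in even_nonroot &, injective (parent e r)}.
Proof.
have odd_sub_parents : Y \subset [set parent e r x | x in even_nonroot].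
  apply/subsetP => y Yy; have [x yx dist_x] := odd_vertex_has_child Yy.
  apply/imsetP; exists x; first exact: child_even dist_x.
  by rewrite (eq_parent tree_e yx dist_x).
have card_even : #|even_nonroot| <= #|Y|.
  have -> : #|even_nonroot| = #|[predD1 [predC Y] & r]|.
    by apply: eq_card => x; rewrite !inE andbC.
  have r_even : r \in [predC Y] by exact: root_even.
  move: cardV; rewrite -(cardC Y) (cardD1 r [predC Y]) r_even.
  by rewrite mul2n -addnn -addnS leq_add2l.
apply/imset_injP; rewrite eqn_leq leq_imset_card.
exact: leq_trans card_even (subset_leq_card odd_sub_parents).
Qed.

Lemma odd_vertex_degree2 y : Y y -> #|e y| = 2.
Proof.
move=> Yy; have [x yx dist_x] := odd_vertex_has_child Yy.
have yr := odd_vertex_neq_root Yy.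
apply: (card_nbrs_one_child tree_e yr yx dist_x) => x' yx' dist_x'.
apply: parent_inj_even; last by rewrite !(@eq_parent _ _ tree_e r y).
  exact: child_even dist_x'.
exact: child_even dist_x.
Qed.

Lemma even_dist_odd c v : ~~ Y c -> Y v = odd (dist e c v).
Proof.
move=> /negPf Yc; have colY := odd_level_two_colouring tree_e r.
by rewrite (two_colouring_odd_level e_conn c v colY) Yc addbF.
Qed.

(* A vertex [t] at distance 3 from [c], its grandparent [z] and a neighbour
   [y != z] of [c] would contradict [codegree_gt0_trans]. *)
Lemma branching_radius_le2 c y1 y2 v :
  ~~ Y c -> e c y1 -> e c y2 -> y1 != y2 -> dist e c v <= 2.
Proof.
move=> Yc cy1 cy2 y12; rewrite leqNgt; apply/negP => v_far.
have [t dist_t] : exists t, dist e c t = 3 by exact: exists_dist_eq v_far.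
have [x xt dist_x] := exists_nbr_closer e_conn dist_t.
have [z zx dist_z] := exists_nbr_closer e_conn dist_x.
have cz : e c z by rewrite -(dist_eq1 tree_e) dist_z.
have [y cy yz] : exists2 y, e c y & y != z.
  have [y1z|] := eqVneq y1 z; last by exists y1.
  by exists y2; rewrite // -y1z eq_sym.
have dist_y := dist_nbr tree_e cy.
have yt : y != t by apply: contra_eq_neq dist_y => ->; rewrite dist_t.
have zt : z != t by apply: contra_eq_neq dist_z => ->; rewrite dist_t.
have /codegree_gt0P[u yu tu] : 0 < codegree e y t.
  have [Yy Yz Yt] : [/\ Y y, Y z & Y t].
    by rewrite !(even_dist_odd _ Yc) dist_y dist_z dist_t.
  apply: (codegree_gt0_trans expands (z := z)); rewrite ?odd_vertex_degree2 //.
  - by rewrite /= Yy Yz Yt.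
  - by rewrite /= !inE negb_or yz yt zt.
  - by apply/codegree_gt0P; exists c; rewrite e_sym.
  - by apply/codegree_gt0P; exists x; rewrite // e_sym.
have ux : u = x.
  have dist_u : dist e c u <= 2.
    by have := dist_edge_le (e_conn c y) yu; rewrite dist_y.
  have ut : e u t by rewrite e_sym.
  apply: (nbr_below_unique tree_e ut xt (r := c)).
    by rewrite dist_t ltnW.
  by rewrite dist_t dist_x.
rewrite ux in yu; case/eqP: yz.
apply: (nbr_below_unique tree_e yu zx (r := c)).
  by rewrite dist_y dist_x.
by rewrite dist_z dist_x.
Qed.

Lemma exists_center : exists2 c, ~~ Y c & forall v, dist e c v <= 2.
Proof.
case: (boolP [forall v, dist e r v <= 2]) => [/forallP|/forallPn[v]].
  by exists r; first exact: root_even.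
rewrite -ltnNge => /(exists_dist_eq e_conn)[t dist_t].
have [x xt dist_x] := exists_nbr_closer e_conn dist_t.
have [y yx dist_y] := exists_nbr_closer e_conn dist_x.
have Yx : ~~ Y x by rewrite /odd_level dist_x.
exists x => // u; apply: (branching_radius_le2 u Yx (y1 := y) (y2 := t)) => //.
  by rewrite e_sym.
by apply: contra_eq_neq dist_y => ->; rewrite dist_t.
Qed.

Lemma kernel_tree_spider : exists k, graph_iso e (spider_edge k).
Proof.
have [c Yc radius_le2] := exists_center.
exists #|e c|; apply: radius2_graph_iso_spider => // y cy.
have colY := odd_level_two_colouring tree_e r.
by apply: odd_vertex_degree2; rewrite (colY _ _ cy).
Qed.

End TreeKernel.

Section GapTree.
Variables (R : realType) (V : finType) (e : rel V).
Hypothesis tree_e : is_tree e.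
Hypothesis nullity_e : nullity R e = 1%N.

Lemma card_le_odd_level r : (#|V| <= (2 * #|odd_level e r|).+1)%N.
Proof.
apply: leq_trans (card_le_mxrank_nullity R e) _; rewrite nullity_e addn1 ltnS.
exact/two_colouring_mxrank/odd_level_two_colouring.
Qed.

Hypothesis gap : forall a : R, eigenvalue (adjacency R e) a -> ~ (0 < a < 1).

Lemma odd_level_expanding (f : V -> R) r :
  adjacency_kernel e f -> f r != 0 -> expanding R e (odd_level e r).
Proof.
move=> kerf fr w w_supp; have colY := odd_level_two_colouring tree_e r.
apply: (kernel_orthogonal_expands (tree_sym tree_e) colY gap) => g kerg.
have f_even_r : (if odd_level e r r then 0 else f r) != 0.
  by rewrite /odd_level distxx.
have kerf_even := two_colouring_kernel colY kerf.
have [a gE] := nullity1_kernel_line nullity_e f_even_r kerf_even kerg.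
apply: big1 => v _; rewrite gE; case: ifPn => [_|/w_supp->].
  by rewrite !mulr0.
by rewrite mul0r.
Qed.

Lemma gap_tree_spider : exists k, graph_iso e (spider_edge k).
Proof.
have [|f [r [fr kerf]]] := @nullity_gt0_kernel R V e.
  by rewrite nullity_e.
apply: (kernel_tree_spider tree_e kerf fr); last exact: card_le_odd_level.
exact: odd_level_expanding kerf fr.
Qed.

End GapTree.

Theorem theorem4p2 (R : realType) (V : finType) (e : rel V)
    (tree_e : is_tree e)
    (nullity_e : nullity R e = 1%N)
    (no_eigenvalue : forall a : R, eigenvalue (adjacency R e) a ->
       ~ (0 < a < 1 \/ 1 < a < 2)) :
  #|V| = 1%N \/ exists p : nat, (1 <= p)%N /\ graph_iso e (S_edge p).
Proof.
have [k iso_e] : exists k, graph_iso e (spider_edge k).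
  apply: (gap_tree_spider tree_e nullity_e) => a /no_eigenvalue not_in_gaps a01.
  by apply: not_in_gaps; left.
have [k0|k_gt0] := posnP k.
  left; have [h /bij_eq_card -> _] := iso_e.
  by rewrite card_option card_prod card_ord k0.
right; have eig_k := graph_iso_eigenvalue iso_e (spider_eigenvalue R k_gt0).
have k_ge3 : (2 < k)%N.
  rewrite ltnNge; apply/negP => k_le2; apply: (no_eigenvalue _ eig_k); right.
  have -> : 2 = Num.sqrt (4%:R : R).
    by rewrite (natrX _ 2 2) sqrtr_sqr ger0_norm.
  by rewrite -{1}sqrtr1 !ltr_sqrt ?ltr0n // ltr1n ltr_nat !ltnS k_gt0.
by case: k k_ge3 iso_e {k_gt0 eig_k} => [|[|[|p]]] // _ iso_e; exists p.+1.
Qed.
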